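(* Let $n\ge1$, let $\rho=\Phi_{\mathrm{YZL}}^{-1}\circ\xi\circ\Phi_{\mathrm{YZL}}:\mathfrak S_n\to\mathfrak S_n$ and let $\pi\in\mathfrak S_n$. Then, componentwise as equalities of (multi)sets, $$(\mathrm{Vnepb},\ \mathrm{Vnepa},\ \mathrm{Vepb},\ \mathrm{Vepa},\ \mathrm{Vnest}\sqcup\mathrm{Vnepb}\setminus\mathrm{Vepa},\ \mathrm{Vnest},\ \mathrm{Vedif}\setminus\mathrm{Vnepb}\setminus\mathrm{Vnepa}\setminus\mathrm{Vnest})(\pi)$$ $$=\kappa_{n+1}\circ(\mathrm{Vepa},\ \mathrm{Vepb},\ \mathrm{Vnepa},\ \mathrm{Vnepb},\ \mathrm{Vnest},\ \mathrm{Vnest}\sqcup\mathrm{Vnepb}\setminus\mathrm{Vepa},\ \mathrm{Vedif}\setminus\mathrm{Vnepb}\setminus\mathrm{Vnepa}\setminus\mathrm{Vnest})(\rho(\pi)),$$ and $$[n-1]\setminus\mathrm{Vnex}(\pi)=\kappa_n(\mathrm{Vnex}(\rho(\pi))).$$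
   Context: $[n]=\{1,\dots,n\}$; $\mathfrak S_n$ is the set of permutations of $[n]$. For multisets, $\sqcup$ adds multiplicities and $\setminus$ subtracts multiplicities, evaluated left to right. $\kappa_N(S)$ is the multiset obtained from $S$ by replacing each element $s$ (with multiplicity) by $N-s$; it is applied componentwise to tuples. Histories. A 2-Motzkin path of length $n$ is a word $w=w_1\cdots w_n$ over $\{\mathrm N,\mathrm S,\mathrm E,\mathrm{dE}\}$ such that, with $h_i:=\#\{j<i: w_j=\mathrm N\}-\#\{j<i: w_j=\mathrm S\}$ for $1\le i\le n+1$, one has $h_i\ge 0$ for all $i$ and $h_{n+1}=0$. An sr-Laguerre history of length $n$ is a triple $W=(w,h,c)$ where $w$ is a 2-Motzkin path of length $n$, $h=h_1\cdots h_n$ is its height sequence, and $c=c_1\cdots c_n$ is a sequence of integers with $0\le c_i\le h_i$ if $w_i\in\{\mathrm N,\mathrm E\}$ and $1\le c_i\le h_i$ if $w_i\in\{\mathrm S,\mathrm{dE}\}$. $\mathfrak L_n$ is the set of all of these; $\mathrm{cs}(W):=\max\{i\in[n]: c_i=0\}$. The map $\xi:\mathfrak L_n\to\mathfrak L_n$ is the unique involution such that for $W=(w,h,c)$ with $\mathrm{cs}(W)=m$ and $\xi(W)=(v,g,b)$: (1) $\mathrm{cs}(\xi(W))=n+1-m$; (2) for $j\ne n+1-m$, $v_j\in\{\mathrm N,\mathrm E\}$ iff $w_{n+1-j}\in\{\mathrm S,\mathrm{dE}\}$; (3) $g_j=h_{n+1-j}+1$ if $j>n+1-m$ and $v_j\in\{\mathrm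 S,\mathrm{dE}\}$, $g_j=h_{n+1-j}-1$ if $j<n+1-m$ and $v_j\in\{\mathrm N,\mathrm E\}$, and $g_j=h_{n+1-j}$ otherwise; (4) $b_j=g_j-h_{n+1-j}+c_{n+1-j}$ for all $j\in[n]$. The bijection $\Phi_{\mathrm{YZL}}:\mathfrak S_n\to\mathfrak L_n$. For $\pi\in\mathfrak S_n$ let $\mathrm{pone}(\pi)=\pi^{-1}(1)$. Define $\Phi_{\mathrm{YZL}}(\pi)=(w,h,c)$ as follows. For $i\in[n-1]$ with $i\ne\mathrm{pone}(\pi)$: $w_i=\mathrm N$ if $i<\pi(i)$ and $i+1\le\pi^{-1}(i+1)$; $w_i=\mathrm S$ if $i\ge\pi(i)$ and $i+1>\pi^{-1}(i+1)$; $w_i=\mathrm E$ if $i<\pi(i)$ and $i+1>\pi^{-1}(i+1)$; $w_i=\mathrm{dE}$ if $i\ge\pi(i)$ and $i+1\le\pi^{-1}(i+1)$. If $i=\mathrm{pone}(\pi)\le n-1$: $w_i=\mathrm N$ if $i+1\le\pi^{-1}(i+1)$ and $w_i=\mathrm E$ if $i+1>\pi^{-1}(i+1)$. Finally $w_n=\mathrm S$ if $\mathrm{pone}(\pi)\ne n$ and $w_n=\mathrm E$ if $\mathrm{pone}(\pi)=n$. The sequence $h$ is the height sequence of $w$, and $c_i=\mathrm{vnest}_i(\pi)+\chi(w_i\in\{\mathrm S,\mathrm{dE}\})$ for $i\in[n]$ ($\chi$ is $1$ if the statement is true, $0$ otherwise), where $\mathrm{nest}_i(\pi)=\#\{j: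 j<i<\pi(i)<\pi(j)\text{ or }\pi(j)<\pi(i)\le i<j\}$ and $\mathrm{vnest}_i(\pi)=\mathrm{nest}_i(\pi)-1$ if $\pi(i)\le i$ and $i<\mathrm{pone}(\pi)$; $\mathrm{vnest}_i(\pi)=\mathrm{nest}_i(\pi)+1$ if $\pi(i)>i$ and $i>\mathrm{pone}(\pi)$; $\mathrm{vnest}_i(\pi)=\mathrm{nest}_i(\pi)$ otherwise. Permutation statistics. $\mathrm{Ep}(\pi)=\{i\in[n]:\pi(i)>i\}$; $\mathrm{Nep}(\pi)=\{i\in[n]:\pi(i)\le i\}$; $\mathrm{Exc}(\pi)=\{\pi(i):\pi(i)>i\}$; $\mathrm{Vnex}(\pi)=\{i\in[n-1]: i+1\notin\mathrm{Exc}(\pi)\}$. $\mathrm{Vnepb},\mathrm{Vepb}$ (resp. $\mathrm{Vnepa},\mathrm{Vepa}$) of $\pi$ are the subsets of $\mathrm{Nep}(\pi),\mathrm{Ep}(\pi)$ of the elements $i<\mathrm{pone}(\pi)$ (resp. $i>\mathrm{pone}(\pi)$). $\mathrm{Vedif}(\pi)$ is the multiset union (adding multiplicities) of the sets $\{i+1,\dots,\pi(i)-1\}$ over $i\in\mathrm{Ep}(\pi)$ together with $\{\mathrm{pone}(\pi)+1,\dots,n\}$. $\mathrm{Vnest}(\pi)$ is the multiset with $\mathrm{vnest}_i(\pi)$ copies of $i$ for each $i\in[n]$. *)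

(* Defs.v *)
From HB Require Import structures.
From mathcomp Require Import all_boot all_order all_fingroup all_algebra.
From mathcomp Require Import finmap multiset zify.

Set Implicit Arguments.
Unset Strict Implicit.
Unset Printing Implicit Defensive.

Import Order.TTheory GRing.Theory Num.Theory.

(* All positions, values and letters are indexed from 1, as naturals; a
   permutation s : 'S_n acts on 'I_n = {0, .., n-1}, and pval s is the
   corresponding map of [n] = {1, .., n} (with junk value 0 outside [n]). *)
Definition pval n (s : 'S_n) (i : nat) : nat :=
  nth 0 (0 :: [seq (s k).+1 | k <- enum 'I_n]) i.

Inductive step := sN | sS | sE | sdE.

(* The two bits are: x in {N, E}, and x in {N, dE}. *)
Definition step_code (x : step) : bool * bool :=
  match x with
  | sN => (true, true) | sS => (false, false)
  | sE => (true, false) | sdE => (false, true)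
  end.
Definition step_decode (b : bool * bool) : step :=
  match b with
  | (true, true) => sN | (false, false) => sS
  | (true, false) => sE | (false, true) => sdE
  end.
Lemma step_codeK : cancel step_code step_decode. Proof. by case. Qed.
HB.instance Definition _ := Equality.copy step (can_type step_codeK).

Definition is_NE (x : step) : bool := x \in [:: sN; sE].
Definition is_SdE (x : step) : bool := x \in [:: sS; sdE].

Definition height (w : seq step) (i : nat) : int :=
  ((count_mem sN (take i.-1 w))%:Z - (count_mem sS (take i.-1 w))%:Z)%R.

Definition motzkin2 n (w : n.-tuple step) : bool :=
  all (fun i => (0 <= height w i)%R) (iota 1 n.+1) && (height w n.+1 == 0%R).

Definition is_history n (wc : n.-tuple step * n.-tuple nat) : bool :=
  let: (w, c) := wc in
  motzkin2 w &&
  all (fun i => let x := nth sN w i.-1 in let ci := nth 0 c i.-1 in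
         (is_SdE x ==> (1 <= ci)) && (ci%:Z <= height w i)%R) (iota 1 n).

(* The triples (w, h, c): h is determined by w, hence not stored. *)
Definition history n := {wc : n.-tuple step * n.-tuple nat | is_history wc}.

Definition wd n (W : history n) (i : nat) : step := nth sN (val W).1 i.-1.
Definition ht n (W : history n) (i : nat) : int := height (val W).1 i.
Definition cl n (W : history n) (i : nat) : nat := nth 0 (val W).2 i.-1.

Definition cs n (W : history n) : nat :=
  \max_(i <- iota 1 n | cl W i == 0) i.

Section Stats.
Variables (n : nat) (s : 'S_n).

Definition pone : nat := pval s^-1 1.

Definition Ep : seq nat := [seq i <- iota 1 n | i < pval s i].
Definition Nep : seq nat := [seq i <- iota 1 n | pval s i <= i].
Definition Exc : seq nat := [seq pval s i | i <- Ep].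

Definition nest (i : nat) : nat :=
  count (fun j => (j < i) && (i < pval s i) && (pval s i < pval s j)
               || (pval s j < pval s i) && (pval s i <= i) && (i < j)) (iota 1 n).

(* The predecessor is a true subtraction: in the first case j = pone is
   counted by nest i (see nest_gt0). *)
Definition vnest (i : nat) : nat :=
  if (pval s i <= i) && (i < pone) then (nest i).-1
  else if (i < pval s i) && (pone < i) then (nest i).+1
  else nest i.

Definition yzl_step (i : nat) : step :=
  let a := i < pval s i in
  let b := i.+1 <= pval s^-1 i.+1 in
  if i == n then (if pone == n then sE else sS)
  else if i == pone then (if b then sN else sE)
  else match a, b with
       | true, true => sN
       | false, false => sS
       | true, false => sE
       | false, true => sdE
       end.

Definition yzl_word : n.-tuple step := [tuple yzl_step k.+1 | k < n].
Definition yzl_col : n.-tuple nat :=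
  [tuple vnest k.+1 + is_SdE (yzl_step k.+1) | k < n].

End Stats.

Section Pval.
Variables (n : nat) (s : 'S_n).

Lemma pvalE (k : 'I_n) : pval s k.+1 = (s k).+1.
Proof.
rewrite /pval /= (nth_map k) ?size_enum_ord //.
by congr (s _).+1; apply: val_inj; rewrite /= nth_enum_ord.
Qed.

Lemma in1n i : (i \in iota 1 n) = (1 <= i <= n).
Proof. by rewrite mem_iota; lia. Qed.

Lemma pvalP i : 1 <= i <= n -> 1 <= pval s i <= n.
Proof.
case: i => [|i]; first by [].
by move=> /andP[_ lt_i]; rewrite (pvalE (Ordinal lt_i)) /= ltn_ord.
Qed.
End Pval.

Lemma pvalK n (s : 'S_n) i : 1 <= i <= n -> pval s^-1 (pval s i) = i.
Proof.
case: i => [|i]; first by [].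
by move=> /andP[_ lt_i]; rewrite (pvalE s (Ordinal lt_i)) pvalE permK.
Qed.

Lemma pvalKV n (s : 'S_n) i : 1 <= i <= n -> pval s (pval s^-1 i) = i.
Proof. by move=> ?; rewrite -{1}(invgK s) pvalK. Qed.

Lemma pval_eq n (s : 'S_n) i v : 1 <= i <= n -> 1 <= v <= n ->
  (pval s i == v) = (i == pval s^-1 v).
Proof.
by move=> hi hv; apply/eqP/eqP => [<-|->]; rewrite (pvalK, pvalKV).
Qed.

Lemma pval_ext n (s t : 'S_n) :
  (forall i, 1 <= i <= n -> pval s i = pval t i) -> s = t.
Proof.
move=> e; apply/permP => k; apply: val_inj; apply: succn_inj.
by rewrite -!pvalE; apply: e; rewrite /= ltn_ord.
Qed.

Lemma height_cons x w i : 0 < i ->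
  height (x :: w) i.+1 = ((is_NE x)%:Z - (x \in [:: sS; sE])%:Z + height w i)%R.
Proof. by case: i => //= i _; rewrite /height /=; case: x => /=; lia. Qed.

Lemma height1 w : height w 1 = 0%R. Proof. by rewrite /height take0. Qed.

Lemma heightS (w : seq step) i : 1 <= i <= size w ->
  height w i.+1 =
  (height w i + (is_NE (nth sN w i.-1))%:Z
     - (nth sN w i.-1 \in [:: sS; sE])%:Z)%R.
Proof.
case: i => // i /= lt_i; rewrite /height /= (take_nth sN lt_i) -cats1.
by rewrite !count_cat /=; case: (nth sN w i) => /=; lia.
Qed.

Lemma nth_word n (s : 'S_n) i : 1 <= i <= n ->
  nth sN (yzl_word s) i.-1 = yzl_step s i.
Proof.
case: i => // i /= lt_i.
exact: (nth_mktuple _ _ (Ordinal lt_i)).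
Qed.

Lemma nth_col n (s : 'S_n) i : 1 <= i <= n ->
  nth 0 (yzl_col s) i.-1 = vnest s i + is_SdE (yzl_step s i).
Proof.
case: i => // i /= lt_i.
exact: (nth_mktuple _ _ (Ordinal lt_i)).
Qed.

Section Landing.
Variables (n : nat) (s : 'S_n).
Hypothesis n_gt0 : 0 < n.
Local Notation P := (pval s).
Local Notation Q := (pval s^-1).

Lemma poneP : 1 <= pone s <= n. Proof. by apply: pvalP; rewrite /= n_gt0. Qed.
Lemma pval_pone : P (pone s) = 1. Proof. by apply: pvalKV; rewrite /= n_gt0. Qed.
Lemma pval_gt1 i : 1 <= i <= n -> i != pone s -> 1 < P i.
Proof.
move=> hi; have := pvalP s hi; have := @pval_eq n s i 1 hi.
rewrite -/(pone s); lia.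
Qed.

Definition crossA i := count (fun j => j < i < P j) (iota 1 n).
Definition crossB i := count (fun j => (P j <= i) && (i < j)) (iota 1 n).

Lemma count_pred1 x : 1 <= x <= n -> count (pred1 x) (iota 1 n) = 1.
Proof. by move=> h; rewrite count_uniq_mem ?iota_uniq // in1n h. Qed.

Lemma countE (T : Type) (a : pred T) r : count a r = \sum_(j <- r) a j.
Proof. by rewrite -sum1_count big_mkcond; apply: eq_bigr => j _; case: (a j). Qed.

Lemma sum_pred1 x (b : nat) : 1 <= x <= n ->
  \sum_(j <- iota 1 n) (j == x) * b = b.
Proof. by move=> h; rewrite -big_distrl -countE /= count_pred1 ?mul1n. Qed.

Lemma crossAS i : 1 <= i < n ->
  crossA i.+1 + (Q i.+1 <= i) = crossA i + (i < P i).
Proof.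
move=> hi; have hQ : 1 <= Q i.+1 <= n by apply: pvalP; lia.
have hi2 : 1 <= i <= n by lia.
rewrite -[X in _ + X = _](sum_pred1 _ hQ) -[X in _ = _ + X](sum_pred1 _ hi2).
rewrite /crossA !countE -!big_split.
apply: eq_big_seq => j; rewrite in1n => hj.
have hi1 : 1 <= i.+1 <= n by lia.
have := pval_eq s hj hi1; rewrite /=.
case: (eqVneq j i) => [->|]; lia.
Qed.

Lemma step_NE i : 1 <= i <= n ->
  is_NE (yzl_step s i) = (i < P i) || (i == pone s).
Proof.
move=> hi; have := pvalP s hi; rewrite /yzl_step.
case: (eqVneq i n) => [->|_].
  rewrite [n == _]eq_sym; case: eqP => _ h; rewrite ?orbT // orbF.
  by apply/esym/negbTE; lia.
case: eqP => _ _; first by rewrite orbT; case: leq.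
by case: (i < P i); case: leq.
Qed.

Lemma step_SdE x : is_SdE x = ~~ is_NE x. Proof. by case: x. Qed.

Lemma step_SE i : 1 <= i < n ->
  (yzl_step s i \in [:: sS; sE]) = (Q i.+1 <= i).
Proof.
move=> hi; rewrite /yzl_step; have -> : (i == n) = false by lia.
have -> : (Q i.+1 <= i) = ~~ (i < Q i.+1) by lia.
by case: eqP => _; case: (_ < P i); case: (_ < Q _).
Qed.

Lemma height_word i : 1 <= i <= n ->
  height (yzl_word s) i = (crossA i + (pone s < i))%:Z%R.
Proof.
have hp := poneP; elim: i => // i IH hi.
case: (posnP i) => [->|i_gt0].
  rewrite height1 (_ : crossA 1 = 0); first by have -> : (pone s < 1) = false by lia.
  apply/eqP; rewrite -leqn0 leqNgt -has_count; apply/hasPn => j.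
  by rewrite in1n; lia.
have hi' : 1 <= i <= n by lia.
rewrite heightS ?size_tuple // nth_word // IH // step_NE // step_SE; last lia.
have := @crossAS i; rewrite /=.
case: (eqVneq i (pone s)) => [e|]; last by lia.
by have := pval_pone; rewrite -e; lia.
Qed.

Lemma height_end : height (yzl_word s) n.+1 = 0%R.
Proof.
have hn : 1 <= n <= n by lia.
have hp := poneP; have hP := pvalP s hn.
rewrite heightS ?size_tuple ?hn // nth_word // height_word //.
have -> : crossA n = 0.
  apply/eqP; rewrite -leqn0 leqNgt -has_count; apply/hasPn => j.
  by rewrite in1n => /(pvalP s); lia.
by rewrite /yzl_step eqxx; case: eqP => h /=; lia.
Qed.

Lemma perm_pval : perm_eq [seq P j | j <- iota 1 n] (iota 1 n).
Proof.
apply: uniq_perm; rewrite ?iota_uniq //.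
  rewrite map_inj_in_uniq ?iota_uniq // => i j; rewrite !in1n => hi hj e.
  by rewrite -(pvalK s hi) e pvalK.
move=> v; rewrite in1n; apply/mapP/idP => [[j]|hv].
  by rewrite in1n => hj ->; apply: pvalP.
by exists (Q v); rewrite ?pvalKV // in1n; apply: pvalP.
Qed.

Lemma crossAB i : P i <= i -> crossA i = crossB i.
Proof.
move=> hi.
have e1 : count (fun j => j <= i) (iota 1 n) = count (fun j => P j <= i) (iota 1 n).
  by rewrite -(seq.permP perm_pval) count_map.
suff : crossA i + count (fun j => P j <= i) (iota 1 n)
     = crossB i + count (fun j => j <= i) (iota 1 n) by rewrite e1 => /addIn.
rewrite /crossA /crossB !countE -!big_split /=; apply: eq_bigr => j _.
by case: (eqVneq j i) => [->|]; lia.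
Qed.

Lemma nest_exc i : i < P i -> nest s i <= crossA i.
Proof. by move=> h; apply: sub_count => j /=; lia. Qed.

Lemma nest_nexc i : P i <= i -> nest s i <= crossA i.
Proof. by move=> h; rewrite crossAB //; apply: sub_count => j /=; lia. Qed.

Lemma nest_gt0 i : 1 <= i <= n -> P i <= i -> i < pone s -> 0 < nest s i.
Proof.
move=> hi h1 h2; rewrite -has_count; apply/hasP; exists (pone s).
  by rewrite in1n poneP.
have ne : i != pone s by lia.
by have := pval_gt1 hi ne; rewrite pval_pone; lia.
Qed.

Lemma nest_pone : nest s (pone s) = 0.
Proof.
have hp := poneP; apply/eqP; rewrite -leqn0 leqNgt -has_count; apply/hasPn => j.
by rewrite in1n => /(pvalP s); rewrite pval_pone; lia.
Qed.

Lemma vnest_pone : vnest s (pone s) = 0.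
Proof. by rewrite /vnest ltnn !andbF nest_pone. Qed.

Lemma Phi_subproof_pos : is_history (yzl_word s, yzl_col s).
Proof.
apply/andP; split; [apply/andP; split|]; last 2 first.
- by rewrite height_end.
- apply/allP => i; rewrite in1n => hi.
  cbv beta zeta; rewrite nth_word // nth_col // height_word //.
  rewrite step_SdE step_NE //.
  case: (eqVneq i (pone s)) => [->|ne].
    by rewrite orbT vnest_pone /=; lia.
  rewrite orbF /vnest; case: (ltnP i (P i)) => hP /=.
    have := nest_exc hP; case: ifP; lia.
  by have := nest_nexc hP; have := nest_gt0 hi hP; case: ifP; lia.
apply/allP => i; rewrite mem_iota => hi.
case: (eqVneq i n.+1) => [->|ne]; first by rewrite height_end.
by rewrite height_word //; lia.
Qed.

End Landing.

Lemma Phi_subproof n (s : 'S_n) : is_history (yzl_word s, yzl_col s).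
Proof.
case: (posnP n) => [n0|]; last exact: Phi_subproof_pos.
by subst n; rewrite !(tuple0 (yzl_word s)) !(tuple0 (yzl_col s)).
Qed.

Definition Phi_YZL n (s : 'S_n) : history n := Sub (_, _) (Phi_subproof s).
Lemma rank_inj (r : seq nat) (f g u z : nat -> nat) :
  {in r &, injective u} -> perm_eq (map f r) (map g r) ->
  {in map f r &, injective z} ->
  {in r, forall i, count (fun j => (u j < u i) && (z (f i) < z (f j))) r
                 = count (fun j => (u j < u i) && (z (g i) < z (g j))) r} ->
  {in r, f =1 g}.
Proof.
move=> uI pfg zI rk.
have [M leM] : exists M, forall j, j \in r -> u j <= M.
  by exists (\max_(j <- r) u j) => j jr; apply: (@leq_bigmax_seq _ r xpredT u).
suff H k i : i \in r -> M - u i < k -> f i = g i.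
  by move=> i ir; apply: H (ltnSn _).
elim: k i => // k IH i ir hk.
have {}IH j : j \in r -> u i < u j -> f j = g j.
  move=> jr lt_ij; apply: IH => //.
  by have := leM j jr; lia.
pose q := [seq j <- r | u j <= u i].
have pq : perm_eq (map f q) (map g q).
  have e : [seq f j | j <- r & ~~ (u j <= u i)]
         = [seq g j | j <- r & ~~ (u j <= u i)].
    by apply/eq_in_map => j; rewrite mem_filter -ltnNge => /andP[? ?]; apply: IH.
  rewrite -(perm_cat2r [seq f j | j <- r & ~~ (u j <= u i)]) {2}e -!map_cat.
  have pr := permEl (perm_filterC (fun j => u j <= u i) r).
  by apply: perm_trans (perm_map f pr) _; rewrite perm_sym;
     apply: perm_trans (perm_map g pr) _; rewrite perm_sym.
have cq (F : nat -> nat) :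
    count (fun j => (u j < u i) && (z (F i) < z (F j))) r
  = count (fun v => z (F i) < z v) (map F q).
  rewrite count_map count_filter; apply: eq_in_count => j jr /=.
  case: (eqVneq j i) => [->|ne]; first by rewrite !ltnn.
  have : u j != u i by apply: contra_neq ne => e; apply: uI.
  by lia.
have fq (F : nat -> nat) : F i \in map F q by apply: map_f; rewrite mem_filter leqnn ir.
have := rk i ir; rewrite !cq -(seq.permP pq) => ec.
have gfq : g i \in map f q by rewrite (perm_mem pq).
have sub v : v \in map f q -> v \in map f r.
  by case/mapP => j; rewrite mem_filter => /andP[_ jr] ->; apply: map_f.
have key x y : x \in map f q -> y \in map f q -> z x < z y ->
    count (fun v => z y < z v) (map f q) < count (fun v => z x < z v) (map f q).
  move=> xq yq ltz.
  have -> : count (fun v => z x < z v) (map f q)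
    = count (fun v => z y < z v) (map f q)
    + count (fun v => z x < z v <= z y) (map f q).
    by rewrite !countE -big_split; apply: eq_bigr => v _ /=; lia.
  rewrite -[X in X < _]addn0 ltn_add2l -has_count; apply/hasP.
  by exists y => //; rewrite ltz leqnn.
case: (ltngtP (z (f i)) (z (g i))) => h.
- by have := key _ _ (fq f) gfq h; rewrite ec ltnn.
- by have := key _ _ gfq (fq f) h; rewrite ec ltnn.
- by apply: zI h; apply: sub.
Qed.

Section Injective.
Variables (n : nat) (s t : 'S_n).
Hypothesis n_gt0 : 0 < n.
Hypothesis eq_step : forall i, 1 <= i <= n -> yzl_step s i = yzl_step t i.
Hypothesis eq_vnest : forall i, 1 <= i <= n -> vnest s i = vnest t i.

Lemma col_gt0 (p : 'S_n) i : 1 <= i <= n -> pone p < i ->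
  0 < vnest p i + is_SdE (yzl_step p i).
Proof.
move=> hi lt_pi; rewrite step_SdE step_NE // /vnest.
have -> : (i == pone p) = false by lia.
by case: (ltnP i (pval p i)) => h; rewrite ?lt_pi /=; lia.
Qed.

Lemma col_pone (p : 'S_n) : vnest p (pone p) + is_SdE (yzl_step p (pone p)) = 0.
Proof. by rewrite vnest_pone // step_SdE step_NE ?poneP // eqxx orbT. Qed.

Lemma eq_pone : pone s = pone t.
Proof.
have hs := poneP s n_gt0; have ht := poneP t n_gt0.
case: (ltngtP (pone s) (pone t)) => // h.
  have := col_gt0 ht h; rewrite eq_step // eq_vnest //.
  by rewrite (col_pone t).
have := col_gt0 hs h; rewrite -eq_step // -eq_vnest //.
by rewrite (col_pone s).
Qed.

Lemma excE (p : 'S_n) i : 1 <= i <= n ->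
  (i < pval p i) = is_NE (yzl_step p i) && (i != pone p).
Proof.
move=> hi; rewrite step_NE //; case: (eqVneq i (pone p)) => [->|_].
  by rewrite pval_pone // andbF; have := poneP p n_gt0; lia.
by rewrite orbF andbT.
Qed.

Lemma eq_exc i : 1 <= i <= n -> (i < pval s i) = (i < pval t i).
Proof. by move=> hi; rewrite !excE // eq_step // eq_pone. Qed.

Lemma eq_excval v : 1 <= v <= n -> (pval s^-1 v < v) = (pval t^-1 v < v).
Proof.
case: v => // -[|v] hv.
  have hs := pvalP s^-1 hv; have ht := pvalP t^-1 hv; lia.
have hi : 1 <= v.+1 < n by lia.
by rewrite !ltnS -!step_SE // eq_step //; lia.
Qed.

Lemma eq_nest i : 1 <= i <= n -> nest s i = nest t i.
Proof.
move=> hi; have := eq_vnest hi; have := eq_exc hi; rewrite /vnest eq_pone.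
have := @nest_gt0 n s n_gt0 i hi; have := @nest_gt0 n t n_gt0 i hi.
have := eq_pone; repeat (case: ifP => ?); lia.
Qed.

Lemma perm_pval_filter (a b : pred nat) :
  {in iota 1 n, forall i, a i = b (pval s i)} ->
  {in iota 1 n, forall i, a i = b (pval t i)} ->
  perm_eq (map (pval s) (filter a (iota 1 n))) (map (pval t) (filter a (iota 1 n))).
Proof.
move=> hs ht; rewrite {1}(eq_in_filter hs) (eq_in_filter ht).
rewrite -(filter_map (pval s) b) -(filter_map (pval t) b).
apply: perm_filter; apply: perm_trans (perm_pval s) _.
by rewrite perm_sym perm_pval.
Qed.

Lemma eq_pval i : 1 <= i <= n -> pval s i = pval t i.
Proof.
move=> hi; case: (ltnP i (pval s i)) => h.
- apply: (@rank_inj (filter (fun j => j < pval s j) (iota 1 n)) _ _ id id) => //.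
  + apply: (perm_pval_filter (b := fun v => pval s^-1 v < v)) => j.
      by rewrite in1n => hj; rewrite pvalK.
    rewrite in1n => hj; have hP := pvalP t hj.
    by rewrite eq_excval // pvalK // eq_exc.
  + move=> j; rewrite mem_filter in1n => /andP[hj1 hj].
    have hj2 := hj1; rewrite eq_exc // in hj2.
    transitivity (nest s j); last rewrite eq_nest //.
      rewrite count_filter; apply: eq_in_count => l; rewrite in1n => hl /=.
      by have := pvalP s hl; lia.
    rewrite count_filter; apply: eq_in_count => l; rewrite in1n => hl /=.
    by rewrite (eq_exc hl); lia.
  + by rewrite mem_filter in1n h.
- apply: (@rank_inj (filter (fun j => pval s j <= j) (iota 1 n)) _ _
                    (fun j => n - j) (fun j => n - j)) => //.
  + by move=> j l; rewrite !mem_filter !in1n; lia.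
  + apply: (perm_pval_filter (b := fun v => v <= pval s^-1 v)) => j.
      by rewrite in1n => hj; rewrite pvalK.
    rewrite in1n => hj; have hP := pvalP t hj.
    by rewrite leqNgt eq_exc // -leqNgt [RHS]leqNgt eq_excval // pvalK // -leqNgt.
  + move=> v w /mapP[j]; rewrite mem_filter in1n => /andP[_ hj] ->.
    move=> /mapP[l]; rewrite mem_filter in1n => /andP[_ hl] ->.
    by have := pvalP s hj; have := pvalP s hl; lia.
  + move=> j; rewrite mem_filter in1n => /andP[hj1 hj].
    have hj2 : pval t j <= j by rewrite leqNgt -eq_exc // -leqNgt.
    transitivity (nest s j); last rewrite eq_nest //.
      rewrite count_filter; apply: eq_in_count => l; rewrite in1n => hl /=.
      by have := pvalP s hl; have := pvalP s hj; lia.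
    rewrite count_filter; apply: eq_in_count => l; rewrite in1n => hl /=.
    by have := eq_exc hl; have := pvalP t hl; have := pvalP t hj; lia.
  + by rewrite mem_filter in1n h.
Qed.

End Injective.

Lemma wd_Phi n (s : 'S_n) i : 1 <= i <= n -> wd (Phi_YZL s) i = yzl_step s i.
Proof. exact: nth_word. Qed.

Lemma cl_Phi n (s : 'S_n) i : 1 <= i <= n ->
  cl (Phi_YZL s) i = vnest s i + is_SdE (yzl_step s i).
Proof. exact: nth_col. Qed.

Lemma Phi_inj n : injective (@Phi_YZL n).
Proof.
move=> s t e; case: (posnP n) => [n0|n_gt0].
  by subst n; apply/permP => -[].
have es i : 1 <= i <= n -> yzl_step s i = yzl_step t i.
  by move=> hi; rewrite -!wd_Phi // e.
have ev i : 1 <= i <= n -> vnest s i = vnest t i.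
  move=> hi; apply: (@addIn (is_SdE (yzl_step s i))).
  by rewrite {2}es // -!cl_Phi // e.
by apply: pval_ext; apply: eq_pval.
Qed.

Definition ext_hist (x : step) (c : nat) (p : seq step * seq nat) :=
  (x :: p.1, c :: p.2).

Fixpoint enum_hist (k h : nat) : seq (seq step * seq nat) :=
  if k isn't k'.+1 then (if h == 0 then [:: ([::], [::])] else [::]) else
    [seq ext_hist sN c p | c <- iota 0 h.+1, p <- enum_hist k' h.+1]
 ++ [seq ext_hist sE c p | c <- iota 0 h.+1, p <- enum_hist k' h]
 ++ [seq ext_hist sS c p | c <- iota 1 h, p <- enum_hist k' h.-1]
 ++ [seq ext_hist sdE c p | c <- iota 1 h, p <- enum_hist k' h].

Lemma enum_histS k h : enum_hist k.+1 h =
    [seq ext_hist sN c p | c <- iota 0 h.+1, p <- enum_hist k h.+1]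
 ++ [seq ext_hist sE c p | c <- iota 0 h.+1, p <- enum_hist k h]
 ++ [seq ext_hist sS c p | c <- iota 1 h, p <- enum_hist k h.-1]
 ++ [seq ext_hist sdE c p | c <- iota 1 h, p <- enum_hist k h].
Proof. by []. Qed.

Lemma size_enum_hist k h : size (enum_hist k h) = k`! * 'C(k, h).
Proof.
elim: k h => [|k IH] h; first by case: h.
rewrite enum_histS !(size_cat, size_map, size_allpairs, size_iota) !IH factS.
have e1 := mul_bin_left k h.
have e2 : h * 'C(k.+1, h) = k.+1 * 'C(k, h.-1) * (0 < h).
  by case: h {e1} => [|h]; rewrite ?muln0 // -mul_bin_diag muln1.
have e3 : (k - h) * 'C(k, h) = k * 'C(k, h) - h * 'C(k, h) by rewrite mulnBl.
have e4 : 'C(k.+1, h) = 'C(k, h) + 'C(k, h.-1) * (0 < h).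
  by case: h {e1 e2 e3} => [|h]; rewrite ?bin0 // binS muln1 addnC.
have e5 : h * 'C(k, h) <= k * 'C(k, h).
  by case: (leqP h k) => hk; [rewrite leq_mul2r hk orbT | rewrite bin_small ?muln0].
have key : h.+1 * 'C(k, h.+1) + h.+1 * 'C(k, h) + h * 'C(k, h.-1) + h * 'C(k, h)
         = k.+1 * 'C(k.+1, h).
  by case: h e1 e2 e3 e4 e5 => [|h] /=; nia.
have := congr1 (muln k`!) key; nia.
Qed.

Lemma mem_cat4 (T : eqType) (x : T) (a b c d : seq T) :
  (x \in a ++ b ++ c ++ d) = [|| x \in a, x \in b, x \in c | x \in d].
Proof. by rewrite !mem_cat. Qed.

Lemma mem_enum_hist k h (w : seq step) (c : seq nat) :
  size w = k -> size c = k ->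
  (forall i, 1 <= i <= k.+1 -> (0 <= h%:Z + height w i)%R) ->
  (h%:Z + height w k.+1 = 0)%R ->
  (forall i, 1 <= i <= k -> (is_SdE (nth sN w i.-1) -> 1 <= nth 0 c i.-1) /\
     ((nth 0 c i.-1)%:Z <= h%:Z + height w i)%R) ->
  (w, c) \in enum_hist k h.
Proof.
elim: k h w c => [|k IH] h [|x w] [|y c] // sw sc h0 h1 hc.
  by rewrite height1 addr0 in h1; case: h h1 {h0 hc}.
case: sw sc => sw [sc].
have hx := hc 1 isT; rewrite height1 /= in hx.
have gen h' : (h'%:Z = h%:Z + ((is_NE x)%:Z - (x \in [:: sS; sE])%:Z))%R ->
    (w, c) \in enum_hist k h'.
  move=> e; apply: IH; try lia.
  - move=> i hi; have hi1 : 1 <= i.+1 <= k.+2 by lia.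
    have := h0 i.+1 hi1; rewrite height_cons; last lia.
    by rewrite e addrA.
  - by move: h1; rewrite height_cons // addrA -e.
  - move=> i hi; have hi1 : 1 <= i.+1 <= k.+1 by lia.
    have := hc i.+1 hi1; rewrite height_cons; last lia.
    by rewrite addrA -e; case: i hi {hi1}.
have hh := h0 2 isT; rewrite height_cons // height1 in hh.
case: x {h0 h1 hc} hx gen hh; rewrite /is_NE /is_SdE [X in X -> _]/= [X in _ -> X -> _]/=
  [X in _ -> _ -> X -> _]/=;
  rewrite enum_histS mem_cat4 => hx gen hh.
- apply/orP; left; apply/allpairsP; exists (y, (w, c)).
  by split=> //; [rewrite mem_iota /= | apply: gen]; lia.
- do 2!(apply/orP; right); apply/orP; left; apply/allpairsP; exists (y, (w, c)).
  case: hx => /(_ isT) hx1 hx2.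
  by split=> //; [rewrite mem_iota /= | apply: gen]; lia.
- apply/orP; right; apply/orP; left; apply/allpairsP; exists (y, (w, c)).
  by split=> //; [rewrite mem_iota /= | apply: gen]; lia.
- do 3!(apply/orP; right); apply/allpairsP; exists (y, (w, c)).
  case: hx => /(_ isT) hx1 hx2.
  by split=> //; [rewrite mem_iota /= | apply: gen]; lia.
Qed.

Lemma historyP n (W : history n) :
  [/\ forall i, 1 <= i <= n.+1 -> (0 <= ht W i)%R,
      ht W n.+1 = 0%R
    & forall i, 1 <= i <= n ->
        (is_SdE (wd W i) -> 1 <= cl W i) /\ ((cl W i)%:Z <= ht W i)%R].
Proof.
case: W => -[w c] /= H; have := H.
move=> /andP[/andP[/allP h0 /eqP h1] /allP hc]; split=> // i hi.
  by apply: h0; rewrite in1n.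
have /hc/andP[/implyP ? ?] : i \in iota 1 n by rewrite in1n.
by split.
Qed.

Lemma Phi_surj n (W : history n) : exists s, Phi_YZL s == W.
Proof.
pose forget (V : history n) := (val (val V).1, val (val V).2).
have forgetI : injective forget.
  by move=> [[w c] ?] [[w' c'] ?] [] /val_inj e1 /val_inj e2; apply/val_inj; congr pair.
pose L := [seq forget (Phi_YZL s) | s <- enum 'S_n].
have memH V : forget V \in enum_hist n 0.
  have [h0 h1 hc] := historyP V.
  apply: mem_enum_hist; rewrite ?size_tuple //.
  - by move=> i hi; rewrite add0r; apply: h0.
  - by rewrite add0r; apply: h1.
  - by move=> i hi; rewrite add0r; apply: hc.
have uL : uniq L by rewrite map_inj_uniq ?enum_uniq // => s t /forgetI/Phi_inj.
have subL : {subset L <= enum_hist n 0} by move=> _ /mapP[s _ ->]; apply: memH.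
have szL : size (enum_hist n 0) <= size L.
  rewrite size_enum_hist bin0 muln1 size_map -cardE.
  by rewrite card_Sn.
have [_ eqL] := uniq_min_size uL subL szL.
have : forget W \in L by rewrite eqL memH.
by case/mapP => s _ /forgetI ->; exists s.
Qed.

Definition Phi_YZL_inv n (W : history n) : 'S_n := xchoose (Phi_surj W).

Lemma Phi_YZLKV n : cancel (@Phi_YZL_inv n) (@Phi_YZL n).
Proof. by move=> W; apply/eqP; apply: (xchooseP (Phi_surj W)). Qed.

Lemma Phi_YZLK n : cancel (@Phi_YZL n) (@Phi_YZL_inv n).
Proof. by move=> s; apply: Phi_inj; rewrite Phi_YZLKV. Qed.
Definition xi_conditions n (W V : history n) : Prop :=
  let m := cs W in
  [/\ cs V = n.+1 - m,
      forall j, 1 <= j <= n -> j != n.+1 - m ->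
        is_NE (wd V j) = is_SdE (wd W (n.+1 - j)),
      forall j, 1 <= j <= n ->
        ht V j =
          (if (n.+1 - m < j)%N && is_SdE (wd V j) then ht W (n.+1 - j) + 1
           else if (j < n.+1 - m)%N && is_NE (wd V j) then ht W (n.+1 - j) - 1
           else ht W (n.+1 - j))%R
    & forall j, 1 <= j <= n ->
        ((cl V j)%:Z = ht V j - ht W (n.+1 - j) + (cl W (n.+1 - j))%:Z)%R].

Definition is_xi n (f : history n -> history n) : Prop :=
  involutive f /\ forall W, xi_conditions W (f W).

Section HistoryTheory.
Variables (n : nat).
Implicit Types (W V : history n).

Lemma history_ext W V :
  (forall i, 1 <= i <= n -> wd W i = wd V i) ->
  (forall i, 1 <= i <= n -> cl W i = cl V i) -> W = V.
Proof.
case: W V => -[w c] HW [[w' c'] HV]; rewrite /wd /cl /= => ew ec.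
apply: val_inj => /=; congr pair; apply: val_inj => /=.
  apply: (@eq_from_nth _ sN); rewrite ?size_tuple // => i lt_i.
  exact: (ew i.+1).
apply: (@eq_from_nth _ 0); rewrite ?size_tuple // => i lt_i.
exact: (ec i.+1).
Qed.

Lemma htS W i : 1 <= i <= n ->
  ht W i.+1 = (ht W i + (is_NE (wd W i))%:Z - (wd W i \in [:: sS; sE])%:Z)%R.
Proof. by move=> hi; rewrite /ht heightS ?size_tuple. Qed.

Lemma step_eqP (x y : step) : is_NE x = is_NE y ->
  (x \in [:: sS; sE]) = (y \in [:: sS; sE]) -> x = y.
Proof. by case: x; case: y. Qed.

Hypothesis n_gt0 : 0 < n.

Lemma cl1 W : cl W 1 = 0.
Proof.
have hn : 1 <= 1 <= n by lia.
have [_ _ /(_ 1 hn)[_]] := historyP W; rewrite /ht height1; lia.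
Qed.

Lemma csP W : [/\ 1 <= cs W <= n, cl W (cs W) = 0
  & forall i, cs W < i -> i <= n -> 0 < cl W i].
Proof.
pose r := [seq i <- iota 1 n | cl W i == 0].
have csE : cs W = \max_(i <- r) i by rewrite /cs big_filter.
have r1 : 1 \in r by rewrite mem_filter cl1 in1n /=; lia.
have le_r i : i \in r -> i <= cs W.
  by move=> ir; rewrite csE; apply: (@leq_bigmax_seq _ r xpredT id).
have : cs W \in r.
  rewrite csE; case: (r) r1 => // x t _.
  elim: t x => [|y t IH] x; first by rewrite big_seq1 inE.
  rewrite big_cons; case: (leqP x (\max_(i <- y :: t) i)) => h.
    by rewrite inE IH orbT.
  by rewrite inE eqxx.
rewrite mem_filter in1n => /andP[/eqP e hm]; split=> // i hi hn.
rewrite lt0n; apply/negP => ci0.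
have /le_r : i \in r by rewrite mem_filter ci0 in1n; lia.
by rewrite leqNgt hi.
Qed.

Lemma cs_uniq W m : 1 <= m <= n -> cl W m = 0 ->
  (forall i, m < i -> i <= n -> 0 < cl W i) -> cs W = m.
Proof.
move=> hm cm hi; have [hc cc hj] := csP W.
case: (ltngtP (cs W) m) => // h.
  by have := hj m h; rewrite cm; lia.
by have := hi (cs W) h; rewrite cc; lia.
Qed.

Lemma cs_NE W : is_NE (wd W (cs W)).
Proof.
have [hc cc _] := csP W; have [_ _ /(_ _ hc)[+ _]] := historyP W.
by rewrite cc step_SdE; case: is_NE => // /(_ isT).
Qed.

Lemma xi_conditions_inj W V V' :
  xi_conditions W V -> xi_conditions W V' -> V = V'.
Proof.
move=> [cV kV gV bV] [cV' kV' gV' bV'].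
have k j : 1 <= j <= n -> is_NE (wd V j) = is_NE (wd V' j).
  move=> hj; case: (eqVneq j (n.+1 - cs W)) => [e|ne]; last by rewrite kV ?kV'.
  by rewrite {1}e -{1}cV e -cV' !cs_NE.
have g j : 1 <= j <= n.+1 -> ht V j = ht V' j.
  move=> hj; case: (eqVneq j n.+1) => [->|ne].
    by have [_ -> _] := historyP V; have [_ -> _] := historyP V'.
  have hj' : 1 <= j <= n by lia.
  by rewrite gV // gV' // !step_SdE k.
apply: history_ext => j hj.
  apply: step_eqP; first exact: k.
  have hj1 : 1 <= j.+1 <= n.+1 by lia.
  have hj2 : 1 <= j <= n.+1 by lia.
  have := g _ hj1; rewrite !htS // (g _ hj2) k //; lia.
have hj2 : 1 <= j <= n.+1 by lia.
by have := bV j hj; have := bV' j hj; rewrite (g _ hj2); lia.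
Qed.

Section Construction.
Variable W : history n.
Local Notation m := (cs W).
Local Notation a i := (is_NE (wd W i)).
Local Notation r i := (wd W i \in [:: sS; sE]).

Definition xiN j := ~~ a (n.+1 - j) || (n.+1 - j == m).
Definition xiR j := (j == n) || ~~ r (n - j).
Definition xi_step j : step := step_decode (xiN j, ~~ xiR j).
Definition xi_col j : nat :=
  let i := n.+1 - j in
  if i < m then cl W i + a i else if m < i then (cl W i + a i).-1 else 0.
Definition xi_ht j : int :=
  let i := n.+1 - j in
  (if (i == 0)%N then 0 else if (i < m)%N then ht W i + (a i)%:Z
   else if (m < i)%N then ht W i + (a i)%:Z - 1 else ht W i)%R.

Definition xi_word : n.-tuple step := [tuple xi_step k.+1 | k < n].
Definition xi_cols : n.-tuple nat := [tuple xi_col k.+1 | k < n].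

Lemma nth_xi_word i : 1 <= i <= n -> nth sN xi_word i.-1 = xi_step i.
Proof. by case: i => // i /= lt_i; exact: (nth_mktuple _ _ (Ordinal lt_i)). Qed.

Lemma nth_xi_cols i : 1 <= i <= n -> nth 0 xi_cols i.-1 = xi_col i.
Proof. by case: i => // i /= lt_i; exact: (nth_mktuple _ _ (Ordinal lt_i)). Qed.

Lemma xi_step_NE j : is_NE (xi_step j) = xiN j.
Proof. by rewrite /xi_step; case: (xiN j); case: (xiR j). Qed.

Lemma xi_step_SE j : (xi_step j \in [:: sS; sE]) = xiR j.
Proof. by rewrite /xi_step; case: (xiN j); case: (xiR j). Qed.

Lemma last_SE : r n.
Proof.
have hn : 1 <= n <= n by lia.
have hn1 : 1 <= n <= n.+1 by lia.
have [h0 h1 /(_ n hn)[]] := historyP W; have := h0 n hn1.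
have := htS W hn; rewrite h1 step_SdE.
by case: (r n); case: (a n) => //=; lia.
Qed.

Lemma xi_height1 : xi_ht 1 = 0%R.
Proof.
have hn : 1 <= n <= n by lia.
have [hc cc hi] := csP W; have := cs_NE W.
have [h0 h1 /(_ n hn)[c1 c2]] := historyP W.
rewrite /xi_ht subSS subn0.
have := htS W hn; rewrite h1 last_SE.
case: (ltngtP n m) => [|h|h]; first lia; last first.
  by rewrite -h; case: (a n) => //; rewrite [_ == 0]eqn0Ngt n_gt0 /=; lia.
have := hi _ h (leqnn n); rewrite [_ == 0]eqn0Ngt n_gt0 /=; lia.
Qed.

Lemma xi_htS j : 1 <= j <= n ->
  xi_ht j.+1 = (xi_ht j + (xiN j)%:Z - (xiR j)%:Z)%R.
Proof.
move=> hj; have [hc _ _] := csP W; have am := cs_NE W.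
have h1 : ht W 1 = 0%R by rewrite /ht height1.
rewrite /xi_ht /xiN /xiR subSS.
have -> : n.+1 - j = (n - j).+1 by lia.
case: (posnP (n - j)) => [e|i_gt0].
  have -> : j == n by lia.
  rewrite e /= h1; case: ifP => hm1.
    have -> : (1 == m) = false by lia.
    by rewrite orbF; lia.
  have e1 : m = 1 by lia.
  by rewrite e1 ltnn eqxx orbT.
have -> : (j == n) = false by lia.
set i := n - j in i_gt0 *.
have hi : 1 <= i <= n by lia.
have hS := htS W hi; rewrite hS /=.
case: (ltngtP i m) => him.
- case: (ltngtP i.+1 m) => him2; try lia.
- case: (ltngtP i.+1 m) => him2; lia.
- by case: (ltngtP i.+1 m) => him2; rewrite him am; lia.
Qed.

Lemma xi_height j : 1 <= j <= n.+1 -> height xi_word j = xi_ht j.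
Proof.
case: j => // j; elim: j => [|j IH] hj; first by rewrite height1 xi_height1.
have hj1 : 1 <= j.+1 <= n by lia.
have hj2 : 1 <= j.+1 <= n.+1 by lia.
rewrite heightS ?size_tuple // nth_xi_word // xi_step_NE xi_step_SE.
by rewrite xi_htS // IH.
Qed.

Lemma xi_history : is_history (xi_word, xi_cols).
Proof.
have [hm cm him] := csP W; have am := cs_NE W.
have bnd i : 1 <= i <= n ->
    (is_SdE (xi_step i) -> 1 <= xi_col i) /\ ((xi_col i)%:Z <= xi_ht i)%R.
  move=> hi; rewrite step_SdE xi_step_NE /xiN /xi_col /xi_ht.
  have hj : 1 <= n.+1 - i <= n by lia.
  have hj1 : 1 <= n.+1 - i <= n.+1 by lia.
  have [h0 _ /(_ _ hj)[c1 c2]] := historyP W; have := h0 _ hj1.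
  set j := n.+1 - i in hj hj1 c1 c2 *.
  have -> : (j == 0) = false by lia.
  rewrite step_SdE in c1.
  case: (ltngtP j m) => hjm.
  - by case: (a j) c1 => /= c1; split=> //; lia.
  - by have := him _ hjm; case: (a j) c1 => /= c1; split=> //; lia.
  - by rewrite orbT.
apply/andP; split; [apply/andP; split|].
- apply/allP => i; rewrite in1n => hi; rewrite xi_height //.
  case: (eqVneq i n.+1) => [->|ne]; first by rewrite /xi_ht subnn.
  have hi' : 1 <= i <= n by lia.
  by have [_] := bnd i hi'; lia.
- by rewrite xi_height ?leqnn // /xi_ht subnn.
- apply/allP => i; rewrite in1n => hi; cbv beta zeta.
  have hi' : 1 <= i <= n.+1 by lia.
  rewrite nth_xi_word // nth_xi_cols // xi_height //.
  by have [? ?] := bnd i hi; apply/andP; split=> //; apply/implyP.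
Qed.

Definition xi_fun : history n := Sub (_, _) xi_history.

Lemma xi_conditions_fun : xi_conditions W xi_fun.
Proof.
have [hm cm him] := csP W; have am := cs_NE W.
have wE j : 1 <= j <= n -> wd xi_fun j = xi_step j by exact: nth_xi_word.
have cE j : 1 <= j <= n -> cl xi_fun j = xi_col j by exact: nth_xi_cols.
have hE j : 1 <= j <= n.+1 -> ht xi_fun j = xi_ht j by exact: xi_height.
have hE' j : 1 <= j <= n -> ht xi_fun j = xi_ht j by move=> ?; apply: hE; lia.
split=> [|j hj ne|j hj|j hj].
- apply: cs_uniq; first lia.
    rewrite cE /xi_col; last lia.
    have -> : n.+1 - (n.+1 - m) = m by lia.
    by rewrite ltnn.
  move=> j h1 h2; have hj : 1 <= j <= n by lia.
  rewrite cE // /xi_col; have -> : n.+1 - j < m by lia.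
  have hi : 1 <= n.+1 - j <= n by lia.
  have [_ _ /(_ _ hi)[+ _]] := historyP W.
  by rewrite step_SdE; case: is_NE => /= [|/(_ isT)]; lia.
- rewrite wE // xi_step_NE step_SdE /xiN.
  have -> : (n.+1 - j == m) = false by lia.
  by rewrite orbF.
- rewrite hE' // wE // step_SdE xi_step_NE /xiN /xi_ht.
  have -> : (n.+1 - j == 0) = false by lia.
  case: (ltngtP (n.+1 - j) m) => h; case: (a (n.+1 - j)) => /=;
    repeat (case: ifP => ?); lia.
- rewrite hE' // cE // /xi_ht /xi_col.
  have -> : (n.+1 - j == 0) = false by lia.
  case: (ltngtP (n.+1 - j) m) => h; try lia.
    by have := him _ h; lia.
  by rewrite h cm; lia.
Qed.

End Construction.

Lemma xi_funK : involutive xi_fun.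
Proof.
move=> W; have [hm cm him] := csP W; have am := cs_NE W.
have [cV _ _ _] := xi_conditions_fun W.
have wE U j : 1 <= j <= n -> wd (xi_fun U) j = xi_step U j by exact: nth_xi_word.
have cE U j : 1 <= j <= n -> cl (xi_fun U) j = xi_col U j by exact: nth_xi_cols.
have sub2 j : 1 <= j <= n -> n.+1 - (n.+1 - j) = j by lia.
apply: history_ext => j hj; have hi : 1 <= n.+1 - j <= n by lia.
  rewrite wE //; apply: step_eqP.
    rewrite xi_step_NE /xiN wE // xi_step_NE /xiN cV sub2 //.
    case: (eqVneq j (cs W)) => [->|ne]; first by rewrite eqxx orbT am.
    have -> : (n.+1 - j == n.+1 - cs W) = false by lia.
    by rewrite !orbF negbK.
  rewrite xi_step_SE /xiR; case: (eqVneq j n) => [->|ne]; first by rewrite last_SE.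
  rewrite wE; last lia.
  rewrite xi_step_SE /xiR; have -> : (n - j == n) = false by lia.
  have -> : n - (n - j) = j by lia.
  by rewrite negbK.
rewrite cE // /xi_col cV wE // xi_step_NE cE // /xi_col /xiN sub2 //.
case: (ltngtP j (cs W)) => h.
- have -> : (n.+1 - j < n.+1 - cs W) = false by lia.
  have -> : n.+1 - cs W < n.+1 - j by lia.
  by case: is_NE => /=; lia.
- have -> : (n.+1 - j < n.+1 - cs W) by lia.
  have : 0 < cl W j by apply: him => //; lia.
  by case: is_NE => /=; lia.
- by rewrite h !ltnn cm.
Qed.

Lemma xi_exists : {f : history n -> history n | is_xi f}.
Proof. by exists xi_fun; split; [exact: xi_funK | exact: xi_conditions_fun]. Qed.

(* The unique map satisfying is_xi: see xiP and xi_unique. *)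
Definition xi : history n -> history n := sval xi_exists.

Lemma xiP : is_xi xi. Proof. exact: svalP xi_exists. Qed.

Lemma xi_unique f : is_xi f -> f =1 xi.
Proof.
by move=> [_ hf] W; have [_ hx] := xiP; apply: xi_conditions_inj (hf W) (hx W).
Qed.

End HistoryTheory.

Definition rho n (hn : 0 < n) : 'S_n -> 'S_n :=
  @Phi_YZL_inv n \o xi hn \o @Phi_YZL n.

Local Open Scope mset_scope.

Section SetStats.
Variables (n : nat) (s : 'S_n).

Definition Vnepb : {mset nat} := seq_mset [seq i <- Nep s | i < pone s].
Definition Vnepa : {mset nat} := seq_mset [seq i <- Nep s | pone s < i].
Definition Vepb : {mset nat} := seq_mset [seq i <- Ep s | i < pone s].
Definition Vepa : {mset nat} := seq_mset [seq i <- Ep s | pone s < i].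

Definition Vnex : {mset nat} :=
  seq_mset [seq i <- iota 1 n.-1 | i.+1 \notin Exc s].

(* index_iota a b enumerates a, a + 1, .., b - 1. *)
Definition Vedif : {mset nat} :=
  seq_mset (flatten [seq index_iota i.+1 (pval s i) | i <- Ep s]
            ++ index_iota (pone s).+1 n.+1).

Definition Vnest : {mset nat} :=
  seq_mset (flatten [seq nseq (vnest s i) i | i <- iota 1 n]).

End SetStats.

(* The set [n]. *)
Definition segment1 (n : nat) : {mset nat} := seq_mset (iota 1 n).

(* Only applied to multisets of naturals <= N, so N - x is never truncated. *)
Definition kappa (N : nat) (A : {mset nat}) : {mset nat} :=
  seq_mset [seq N - x | x <- A].

Section Inclusions.
Variables (n : nat) (s : 'S_n).
Hypothesis n_gt0 : 0 < n.

Lemma count_iota1 i : count (pred1 i) (iota 1 n) = (1 <= i <= n) :> nat.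
Proof. by rewrite count_uniq_mem ?iota_uniq // in1n. Qed.

Lemma mset_filterE (a b : pred nat) i :
  seq_mset [seq j <- [seq j <- iota 1 n | a j] | b j] i
  = (1 <= i <= n) && a i && b i :> nat.
Proof.
rewrite mset_seqE count_uniq_mem ?filter_uniq ?iota_uniq //.
by rewrite !mem_filter in1n; case: (_ <= _ <= _); case: (a i); case: (b i).
Qed.

Lemma VnestE i : 1 <= i <= n -> Vnest s i = vnest s i.
Proof.
move=> hi; rewrite /Vnest mset_seqE count_flatten sumn_map big_map.
rewrite -[RHS](@sum_pred1 n i) //; apply: eq_bigr => j _.
by rewrite count_nseq /=; case: eqP => [->|]; rewrite ?mul0n.
Qed.

Lemma VedifE i : 1 <= i <= n -> Vedif s i = crossA s i + (pone s < i).
Proof.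
move=> hi; rewrite /Vedif mset_seqE count_cat count_flatten sumn_map big_map.
congr (_ + _); last first.
  by rewrite count_uniq_mem ?iota_uniq // mem_index_iota; lia.
rewrite /Ep big_filter /crossA countE big_mkcond; apply: eq_bigr => j _.
rewrite count_uniq_mem ?iota_uniq // mem_index_iota; case: ifP; lia.
Qed.

(* The multiset differences in the statement are true differences. *)
Lemma Vepa_sub : Vepa s `<=` Vnest s `+` Vnepb s.
Proof.
apply/msubsetP => i; rewrite msetE2 /Vepa mset_filterE.
case: (boolP (1 <= i <= n)) => //= hi; rewrite VnestE // /vnest.
case: (ltnP i (pval s i)) => h //=.
by case: (ltnP (pone s) i) => h'; rewrite ?andbF //=; lia.
Qed.

Lemma Vedif_sub : Vnepb s `+` Vnepa s `+` Vnest s `<=` Vedif s.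
Proof.
apply/msubsetP => i; rewrite !msetE2 /Vnepb /Vnepa !mset_filterE.
case: (boolP (1 <= i <= n)) => /= hi; last first.
  suff -> : Vnest s i = 0 by [].
  rewrite /Vnest mset_seqE; apply/count_memPn/flattenP => -[t /mapP[j]].
  by rewrite in1n => hj -> /nseqP[e _]; rewrite e hj in hi.
have [_ _ /(_ i hi)[_]] := historyP (Phi_YZL s).
rewrite cl_Phi // {1}/ht height_word // VnestE // VedifE // step_SdE step_NE //.
case: (eqVneq i (pone s)) => [e|ne]; last by lia.
by rewrite e vnest_pone // !ltnn !andbF; lia.
Qed.

End Inclusions.

(* Main.v *)
Require Import Defs.
From mathcomp Require Import all_boot all_order all_fingroup all_algebra.
From mathcomp Require Import finmap multiset zify.

(* Everything is compared pointwise.  Since the value 1 sits at the last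
   position of color 0, cs (Phi_YZL s) = pone s; hence the conditions defining
   xi say that i -> n + 1 - i sends pone p to pone (rho p), exchanges excedances
   and non-excedances elsewhere, and shifts heights and colors by amounts
   that depend only on the side of pone and on the type of i.  The multiplicity
   of i in Vedif is the height at i, so all the identities are linear. *)

(* perm.pval would otherwise shadow it. *)
Local Notation pval := Defs.pval.

(** The bound on [A] makes [N - _] injective on its elements, so each multiplicity has one source;
    elements above [N] would all be truncated to 0. *)
Lemma kappaE (N : nat) (A : {mset nat}%mset) i :
  {in A, forall x, x <= N} -> kappa N A i = if i <= N then A (N - i) else 0.
Proof.
move=> hA; rewrite mset_seqE count_map; case: leqP => hi.
  rewrite -[RHS]count_mem_mset; apply: eq_in_count => x /hA /= hx.
  by apply/eqP/eqP; lia.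
apply/eqP; rewrite -leqn0 leqNgt -has_count; apply/hasPn => x /hA /=; lia.
Qed.

(** Vanishing outside [n] supplies the bound of [kappaE] and settles [i = 0], which is paired with
    [n.+1]. *)
Lemma eq_kappa (n : nat) (A B : {mset nat}%mset) :
  (forall i, ~~ (1 <= i <= n) -> A i = 0) ->
  (forall i, ~~ (1 <= i <= n) -> B i = 0) ->
  (forall i, 1 <= i <= n -> A i = B (n.+1 - i)) ->
  A = kappa n.+1 B.
Proof.
move=> hA hB hAB; apply/msetP => i; rewrite kappaE; last first.
  move=> x; rewrite in_mset; case: (boolP (1 <= x <= n)) => [|/hB ->]; lia.
case: (boolP (1 <= i <= n)) => hi.
  by rewrite hAB //; case: leqP; lia.
rewrite hA //; case: leqP => // h; rewrite hB //; lia.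
Qed.

Lemma Vnest_out n (s : 'S_n) i : ~~ (1 <= i <= n) -> Vnest s i = 0.
Proof.
move=> hi; rewrite /Vnest mset_seqE; apply/count_memPn/flattenP => -[t /mapP[j]].
by rewrite in1n => hj -> /nseqP[e _]; rewrite e hj in hi.
Qed.

Lemma Vedif_out n (s : 'S_n) i : ~~ (1 <= i <= n) -> Vedif s i = 0.
Proof.
move=> hi; rewrite /Vedif mset_seqE; apply/count_memPn.
rewrite mem_cat mem_index_iota negb_or; apply/andP; split; last lia.
apply/flattenP => -[t /mapP[j]].
rewrite mem_filter in1n => /andP[_ hj] ->; rewrite mem_index_iota.
by have := pvalP s hj; lia.
Qed.

(** Right of [pone s] every color is positive: [vnest] adds 1 at excedances, the letters S and dE
    add 1 elsewhere. *)
Lemma cs_Phi n (s : 'S_n) : 0 < n -> cs (Phi_YZL s) = pone s.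
Proof.
move=> hn; have hp := poneP s hn.
apply: cs_uniq => //; first by rewrite cl_Phi // col_pone.
move=> i h1 h2; have hi : 1 <= i <= n by lia.
by rewrite cl_Phi //; apply: col_gt0.
Qed.

Lemma Phi_rho n (hn : 0 < n) (s : 'S_n) :
  Phi_YZL (rho hn s) = xi hn (Phi_YZL s).
Proof. exact: Phi_YZLKV. Qed.

(** Gives access to the explicit second bit [xiR] of each letter, which the conditions on [xi]
    control only through heights. *)
Lemma xi_funE n (hn : 0 < n) (W : history n) : xi hn W = xi_fun hn W.
Proof.
have [_ hx] := xiP hn.
exact: (xi_conditions_inj hn (hx W) (xi_conditions_fun hn W)).
Qed.

Lemma ExcE n (s : 'S_n) i : 1 <= i < n ->
  (i.+1 \in Exc s) = (yzl_step s i \in [:: sS; sE]).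
Proof.
move=> hi; have hi1 : 1 <= i.+1 <= n by lia.
have hn : 0 < n by lia.
rewrite step_SE //; apply/mapP/idP => [[j]|h].
  by rewrite mem_filter in1n => /andP[h hj] e; rewrite e pvalK //; lia.
exists (pval s^-1 i.+1); rewrite ?pvalKV // mem_filter in1n pvalKV //.
by have := pvalP s^-1 hi1; lia.
Qed.

Section Rho.
Variables (n : nat) (hn : 0 < n) (p : 'S_n).
Let r := rho hn p.

Lemma rho_xi_conditions : xi_conditions (Phi_YZL p) (Phi_YZL r).
Proof. by rewrite Phi_rho; have [_] := xiP hn; apply. Qed.

Lemma pone_rho : pone r = n.+1 - pone p.
Proof. by have [e _ _ _] := rho_xi_conditions; rewrite -!cs_Phi. Qed.

(** Away from [pone] the letters N and E mark exactly the excedances, so this is condition (2) on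
    [xi]. *)
Lemma exc_rho i : 1 <= i <= n -> i != pone p ->
  (n.+1 - i < pval r (n.+1 - i)) = (pval p i <= i).
Proof.
move=> hi ne; have hp := poneP p hn; have hj : 1 <= n.+1 - i <= n by lia.
have [_ /(_ _ hj) + _ _] := rho_xi_conditions.
rewrite cs_Phi // subKn; last lia.
rewrite !wd_Phi // step_SdE !step_NE // pone_rho.
by lia.
Qed.

(** Conditions (3) and (4) on [xi], with negative terms moved across to stay in the naturals. Both
    carry the same corrections, so height minus color, the last component of the tuple, is
    preserved. *)
Lemma ht_cl_rho i : 1 <= i <= n ->
  let j := n.+1 - i in
  crossA r j + (pone r < j) + ((j < pone r) && (j < pval r j)) =
  crossA p i + (pone p < i) + ((pone r < j) && (pval r j <= j)) /\
  vnest r j + ((j != pone r) && (pval r j <= j)) +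
    ((j < pone r) && (j < pval r j)) =
  vnest p i + ((i != pone p) && (pval p i <= i)) +
    ((pone r < j) && (pval r j <= j)).
Proof.
move=> hi j; have hp := poneP p hn; have hj : 1 <= j <= n by lia.
have [_ _ /(_ _ hj) + /(_ _ hj)] := rho_xi_conditions.
have -> : n.+1 - j = i by lia.
rewrite cs_Phi // -pone_rho !cl_Phi // /ht !height_word // !wd_Phi //.
rewrite !step_SdE !step_NE //.
have := poneP r hn; have := pval_pone r hn; have := pval_pone p hn.
case: (eqVneq j (pone r)) => [e|_]; case: (eqVneq i (pone p)) => [e'|_];
  by rewrite ?e ?e'; repeat case: ifP; lia.
Qed.
End Rho.

Theorem corollary4p18 (n : nat) (hn : 0 < n) (p : 'S_n) :
  let r := rho hn p in
  ( Vnepb p, Vnepa p, Vepb p, Vepa p,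
    (Vnest p `+` Vnepb p) `\` Vepa p,
    Vnest p,
    ((Vedif p `\` Vnepb p) `\` Vnepa p) `\` Vnest p )%mset
  = ( kappa n.+1 (Vepa r), kappa n.+1 (Vepb r),
      kappa n.+1 (Vnepa r), kappa n.+1 (Vnepb r),
      kappa n.+1 (Vnest r),
      kappa n.+1 ((Vnest r `+` Vnepb r) `\` Vepa r),
      kappa n.+1 (((Vedif r `\` Vnepb r) `\` Vnepa r) `\` Vnest r) )%mset
  /\ (segment1 n.-1 `\` Vnex p = kappa n (Vnex r))%mset.
Proof.
move=> r; have hp := poneP p hn; have hpr := pone_rho n hn p.
rewrite -/r in hpr; split; last first.
  apply/msetP => i; rewrite kappaE; last first.
    by move=> x; rewrite in_mset /Vnex mset_seqE -has_count => /hasP[y];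
       rewrite mem_filter mem_iota => /andP[_ hy] /= /eqP <-; lia.
  have VnexE (s : 'S_n) j : Vnex s j = (1 <= j < n) && (j.+1 \notin Exc s) :> nat.
    rewrite mset_seqE count_uniq_mem ?filter_uniq ?iota_uniq // mem_filter in1n.
    by rewrite andbC; congr (_ && _ : nat); lia.
  rewrite !msetE2 mset_seqE count_iota1 !VnexE.
  case: (boolP (1 <= i < n)) => hi; last by case: ifP => ?; lia.
  have hj : 1 <= n - i < n by lia.
  have hj1 : 1 <= n - i <= n by lia.
  have hi1 : 1 <= i <= n by lia.
  rewrite !ExcE // -!wd_Phi // Phi_rho xi_funE.
  (* The second bit at [i] concerns the value [i.+1], so it is negated under [i -> n - i] instead of
     [n.+1 - i]. *)
  rewrite [wd (xi_fun _ _) _]nth_xi_word // xi_step_SE /xiR subKn; last lia.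
  have -> : i <= n by lia.
  by case: (wd _ i \in _) => /=; lia.
do !congr pair; (apply: eq_kappa => i hi; rewrite ?msetE2;
  [by rewrite ?Vnest_out ?Vedif_out ?mset_filterE ?(negbTE hi)
  |by rewrite ?Vnest_out ?Vedif_out ?mset_filterE ?(negbTE hi)|]).
all: have hj : 1 <= n.+1 - i <= n by lia.
all: have he := exc_rho n hn p i hi.
all: have [] := ht_cl_rho n hn p i hi; rewrite -/r in he *; move=> h1 h2.
all: rewrite ?VnestE ?VedifE ?mset_filterE // ?hi ?hj /=.
all: have := pval_pone p hn; have := pval_pone r hn; have := poneP r hn.
all: set j := n.+1 - i in hj he h1 h2 *.
all: have hij : i + j = n.+1 by lia.
all: clearbody j r; have e1 : (pone r < j) = (i < pone p) by lia.
all: have e2 : (j < pone r) = (pone p < i) by lia.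
(* At [pone] all side indicators vanish, and [h1], [h2] equate the counts directly. *)
all: case: (eqVneq i (pone p)) he h1 h2 => [e|ne] he h1 h2;
  first by have ej : j = pone r by [lia]; subst i j; lia.
all: have {}he := he isT.
all: have ej : (j != pone r) = true by lia.
all: have e3 : (pval r j <= j) = (i < pval p i) by lia.
all: rewrite ?e1 ?e2 ?e3 ?he ?ej in h1 h2 *.
(* All indicators of [r] at [j] are now those of [p] at [i]: the side of [pone] and the type of [i]
   leave four linear cases. *)
all: case: (ltngtP i (pone p)) ne h1 h2 => // _ _;
  by case: (ltnP i (pval p i)) => _ /=; lia.
Qed.
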